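(* For every positive integer $n$, let $\mathcal T^{Sym}_{2n+1}$ be the set of symmetric tree-like tableaux of size $2n+1$. Then $$oc(\mathcal T^{Sym}_{2n+1})=\sum_{T\in\mathcal T^{Sym}_{2n+1}}oc(T)=2^n n!.$$ (Since $|\mathcal T^{Sym}_{2n+1}|=2^nn!$, on average there is one occupied corner per symmetric tree-like tableau.)
   Context: A tree-like tableau is a filling of a Young diagram (English convention) in which some cells contain a point, subject to: (1) the top-left cell contains a point (the root point); (2) for each other point, there is a point above it in the same column or a point to its left in the same row, but not both; (3) there is no empty row and no empty column. The size is the number of points. A tree-like tableau is symmetric if it (shape and points) is invariant under reflection in its main diagonal; such tableaux have odd size, and there are $2^nn!$ of size $2n+1$. A corner is a cell whose bottom and right edges both lie on the Southeast boundary; it is occupied if it contains a point; $oc(T)$ is the number of occupied corners. *)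

(* Defs.v *)
From HB Require Import structures.
From mathcomp Require Import all_boot all_order all_algebra.
From mathcomp Require Import finmap.

Set Implicit Arguments.
Unset Strict Implicit.
Unset Printing Implicit Defensive.

Local Open Scope fset_scope.

(* A cell is a pair (row, column); rows are numbered from the top and columns
   from the left, both starting at 0. *)
Notation cell := (nat * nat)%type.

(* A filled diagram: the finite set of its cells, and the finite set of the
   cells that contain a point. *)
Notation tableau := ({fset cell} * {fset cell})%type.

Definition diagram (T : tableau) : {fset cell} := T.1.
Definition points (T : tableau) : {fset cell} := T.2.

Definition tab_size (T : tableau) : nat := #|` points T|.

(* Young diagrams are the finite sets of cells closed under moving up and
   left, i.e. left-justified rows of weakly decreasing lengths. *)
Definition young (D : {fset cell}) : bool :=
  [forall c : D, forall i : 'I_(val c).1.+1, forall j : 'I_(val c).2.+1,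
     (val i, val j) \in D].

Definition point_above (P : {fset cell}) (c : cell) : bool :=
  [exists i : 'I_c.1, (val i, c.2) \in P].

Definition point_left (P : {fset cell}) (c : cell) : bool :=
  [exists j : 'I_c.2, (c.1, val j) \in P].

Definition no_empty_row (T : tableau) : bool :=
  [forall c : diagram T, exists p : points T, (val p).1 == (val c).1].

Definition no_empty_column (T : tableau) : bool :=
  [forall c : diagram T, exists p : points T, (val p).2 == (val c).2].

Definition tree_like (T : tableau) : bool :=
  [&& young (diagram T),
      points T `<=` diagram T,
      (0, 0) \in points T,
      [forall p : points T, (val p != (0, 0)) ==>
         (point_above (points T) (val p) (+) point_left (points T) (val p))],
      no_empty_row T
    & no_empty_column T].

Definition transpose (c : cell) : cell := (c.2, c.1).

Definition symmetric_tab (T : tableau) : bool :=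
  (transpose @` diagram T == diagram T) && (transpose @` points T == points T).

Definition corner (D : {fset cell}) (c : cell) : bool :=
  [&& c \in D, (c.1.+1, c.2) \notin D & (c.1, c.2.+1) \notin D].

Definition oc (T : tableau) : nat :=
  #|` [fset c in points T | corner (diagram T) c]|.

Definition box (m : nat) : {fset cell} :=
  [fset x | x in iota 0 m] `*` [fset x | x in iota 0 m].

(* The bounding box only serves to obtain a finite set; by symTLTP below it
   excludes no symmetric tree-like tableau of size 2n+1. *)
Definition symTLT (n : nat) : {fset tableau} :=
  [fset T in fpowerset (box n.*2.+1) `*` fpowerset (box n.*2.+1)
   | [&& tree_like T, symmetric_tab T & tab_size T == n.*2.+1]].

Lemma boxE m c : (c \in box m) = (c.1 < m) && (c.2 < m).
Proof. by rewrite in_fsetM !inE /= !mem_iota !add0n. Qed.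

Lemma leq_card_coord (f : cell -> nat) (P : {fset cell}) m :
  (forall k, k < m -> exists2 p, p \in P & f p = k) -> m <= #|` P|.
Proof.
move=> h; rewrite -(size_iota 0 m) -(size_map f P).
apply: uniq_leq_size (iota_uniq _ _) _ => k; rewrite mem_iota add0n /=.
by case/h=> p pP <-; apply: map_f.
Qed.

Lemma tree_like_box T : tree_like T -> diagram T `<=` box (tab_size T).
Proof.
case/and5P=> /forallP Y _ _ _ /andP[/forallP R /forallP C].
apply/fsubsetP => c cD; rewrite boxE; apply/andP.
have up k l : k <= c.1 -> l <= c.2 -> (k, l) \in diagram T.
  move=> hk hl; have /forallP/(_ (Ordinal (hk : k < c.1.+1))) := Y [` cD].
  by move/forallP/(_ (Ordinal (hl : l < c.2.+1))).
split; [apply: (@leq_card_coord fst) | apply: (@leq_card_coord snd)] => k hk.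
  by have /existsP[p /eqP e] := R [` up k 0 hk isT]; exists (val p); rewrite ?fsvalP.
by have /existsP[p /eqP e] := C [` up 0 k isT hk]; exists (val p); rewrite ?fsvalP.
Qed.

Lemma symTLTP n T :
  (T \in symTLT n) =
  [&& tree_like T, symmetric_tab T & tab_size T == n.*2.+1].
Proof.
rewrite !inE /=; apply: andb_idl => /and3P[hT _ /eqP hs].
have hD := tree_like_box hT; rewrite hs in hD.
have /and5P[_ hP _ _ _] := hT.
by rewrite !fpowersetE hD (fsubset_trans hP hD).
Qed.

(* Main.v *)
(* Say that a cell outside the diagram is addable if its upper and left
   neighbours exist and are in the diagram. A Young diagram has exactly one
   more corner than it has addable cells. Removing an empty corner together
   with its mirror image turns pairs (T, empty corner) bijectively into pairs
   (T, addable cell); summing over all symmetric tree-like tableaux of a given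
   size, the empty corners cancel the addable cells and the number of tableaux
   equals the total number of occupied corners.

   An occupied corner has no other point in its row or no other point in its
   column, and the two kinds are exchanged by the symmetry. Deleting the row of
   a corner of the first kind and the mirror column leaves a symmetric tableau
   with two points less, in which the corner is remembered by the column it was
   hanging from. A symmetric tableau of size 2n+1 has n+1 columns, so the common
   value a(n) of both counts satisfies a(n+1) = 2(n+1) a(n), with a(0) = 1. *)
Require Import Defs.
From HB Require Import structures.
From mathcomp Require Import all_boot all_order all_algebra.
From mathcomp Require Import finmap zify.
Set Implicit Arguments.
Unset Strict Implicit.
Unset Printing Implicit Defensive.
Local Open Scope fset_scope.
Local Open Scope nat_scope.

(** * Comparing counts of pairs, and counting over a square grid *)

(** Each sum counts related pairs, and [f] is injective on those of the left side because [g] undoes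
    it there. Exchanging [f] and [g] turns a bijection into two inequalities. *)
Lemma leq_sum_count (S S' U U' : eqType) (A : seq S) (B : seq U) (A' : seq S')
    (B' : seq U') (Q : S -> pred U) (Q' : S' -> pred U')
    (f : S * U -> S' * U') (g : S' * U' -> S * U) :
  uniq A -> uniq B ->
  (forall a b, a \in A -> b \in B -> Q a b ->
    [/\ (f (a, b)).1 \in A', (f (a, b)).2 \in B',
        Q' (f (a, b)).1 (f (a, b)).2 & g (f (a, b)) = (a, b)]) ->
  \sum_(a <- A) count (Q a) B <= \sum_(a <- A') count (Q' a) B'.
Proof.
move=> uA uB fP.
pose pairs (V W : eqType) (C : seq V) (E : seq W) (R : V -> pred W) :=
  [seq (a, b) | a <- C, b <- [seq b <- E | R a b]].
have pairsE (V W : eqType) (C : seq V) (E : seq W) R a b :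
  ((a, b) \in pairs V W C E R) = [&& a \in C, b \in E & R a b].
  apply/allpairsPdep/and3P => [[x [y [xC]]]|[aC bE ab]].
    by rewrite mem_filter => /andP[xy yE] [-> ->].
  by exists a, b; rewrite mem_filter ab bE aC.
have sizeE (V W : eqType) (C : seq V) (E : seq W) R :
  \sum_(a <- C) count (R a) E = size (pairs V W C E R).
  rewrite size_allpairs_dep sumnE big_map.
  by apply: eq_bigr => a _; rewrite size_filter.
rewrite !sizeE -(size_map f); apply: uniq_leq_size.
  rewrite map_inj_in_uniq.
    apply: allpairs_uniq_dep => // [a _|]; first exact: filter_uniq.
    by move=> [a b] [a' b'] _ _ /= [-> ->].
  move=> [a b] [a' b']; rewrite !pairsE => /and3P[aA bB ab] /and3P[aA' bB' ab'].
  move=> /(congr1 g).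
  by have [_ _ _ ->] := fP _ _ aA bB ab; have [_ _ _ ->] := fP _ _ aA' bB' ab'.
move=> y /mapP[[a b]]; rewrite pairsE => /and3P[aA bB ab] ->.
by have [h1 h2 h3 _] := fP _ _ aA bB ab; rewrite [f _]surjective_pairing pairsE h1 h2.
Qed.

(** A range of cells common to all tableaux of a given size, over which counts unfold into double
    sums. *)
Definition cells (m : nat) : seq cell := [seq (i, j) | i <- iota 0 m, j <- iota 0 m].

Lemma mem_cells m i j : ((i, j) \in cells m) = (i < m) && (j < m).
Proof.
apply/allpairsP/andP => [[[x y]] /= |[im jm]].
  by rewrite !mem_iota !add0n => -[xm ym [-> ->]].
by exists (i, j); rewrite !mem_iota.
Qed.

Lemma cells_uniq m : uniq (cells m).
Proof. by apply: allpairs_uniq; rewrite ?iota_uniq // => -[? ?] [? ?]. Qed.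

Lemma count_cells m (Q : pred cell) :
  count Q (cells m) = \sum_(0 <= i < m) \sum_(0 <= j < m) Q (i, j).
Proof.
rewrite -sum1_count big_mkcond big_allpairs /index_iota subn0.
by apply: eq_bigr => i _; apply: eq_bigr => j _; case: (Q _).
Qed.

(** * Symmetric tree-like tableaux in coordinates *)

Definition leftp (P : {fset cell}) (i j : nat) : bool :=
  has (fun l => (i, l) \in P) (iota 0 j).

Lemma leftpP (P : {fset cell}) i j :
  reflect (exists2 l, l < j & (i, l) \in P) (leftp P i j).
Proof.
apply: (iffP hasP) => -[l]; first by rewrite mem_iota add0n; exists l.
by exists l; rewrite // mem_iota.
Qed.

Definition young_closed (D : {fset cell}) : Prop :=
  forall i j k l : nat, (i, j) \in D -> k <= i -> l <= j -> (k, l) \in D.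

(* By the symmetry of [P], [leftp P j i] says that a point lies above [(i, j)]. *)
Record sym_tlt (n : nat) (D P : {fset cell}) : Prop := SymTlt {
  st_young : young_closed D;
  st_symD : forall i j : nat, ((i, j) \in D) = ((j, i) \in D);
  st_symP : forall i j : nat, ((i, j) \in P) = ((j, i) \in P);
  st_sub : forall i j : nat, (i, j) \in P -> (i, j) \in D;
  st_root : (0, 0) \in P;
  st_tree : forall i j : nat, (i, j) \in P -> (i, j) != (0, 0) ->
    leftp P j i = ~~ leftp P i j;
  st_row : forall i j : nat, (i, j) \in D -> exists l : nat, (i, l) \in P;
  st_size : #|` P| = n.*2.+1 }.

Lemma youngP D : reflect (young_closed D) (young D).
Proof.
apply: (iffP forallP) => [Y i j k l ijD ki lj | Y c].
  have /forallP/(_ (Ordinal (ki : k < i.+1))) := Y [` ijD].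
  by move/forallP/(_ (Ordinal (lj : l < j.+1))).
apply/forallP => k; apply/forallP => l; have : val c \in D by apply: fsvalP.
by case: (val c) k l => i j k l ijD; exact: (Y i j _ _ ijD (ltn_ord k) (ltn_ord l)).
Qed.

Lemma transpose_fsetP (A : {fset cell}) :
  reflect (forall i j, ((i, j) \in A) = ((j, i) \in A)) (transpose @` A == A).
Proof.
apply: (iffP eqP) => [e i j | e].
  have t k l : (k, l) \in A -> (l, k) \in A.
    by move=> kl; rewrite -e; apply/imfsetP; exists (k, l).
  by apply/idP/idP; apply: t.
apply/fsetP => -[i j]; apply/imfsetP/idP => /= [[[k l] kl [-> ->]]|ij].
  by rewrite e.
by exists (j, i); rewrite // e.
Qed.

Lemma point_leftE P i j : point_left P (i, j) = leftp P i j.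
Proof.
apply/existsP/leftpP => [[l h]|[l lj h]]; first by exists (val l); [exact: ltn_ord | exact: h].
by exists (Ordinal (lj : l < (i, j).2)).
Qed.

Lemma point_aboveE (P : {fset cell}) i j :
  (forall i j, ((i, j) \in P) = ((j, i) \in P)) ->
  point_above P (i, j) = leftp P j i.
Proof.
move=> sP; apply/existsP/leftpP => [[l h]|[l lj h]]; first by exists (val l); [exact: ltn_ord | rewrite sP].
by exists (Ordinal (lj : l < (i, j).1)); rewrite /= sP.
Qed.

Lemma mem_symTLT n D P : reflect (sym_tlt n D P) ((D, P) \in symTLT n).
Proof.
rewrite symTLTP; apply: (iffP and3P).
  case=> /and5P[/youngP Y /fsubsetP PD r /forallP tr /andP[/forallP R _]].
  case/andP=> /transpose_fsetP sD /transpose_fsetP sP /eqP sz.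
  split=> // [i j /PD //|i j ij|i j ij].
    move=> nr; have := implyP (tr [` ij]) nr; rewrite /= point_leftE (point_aboveE _ _ sP).
    by case: leftp; case: leftp.
  have /existsP[p /eqP /= e] := R [` ij].
  by exists (val p).2; rewrite -e -surjective_pairing fsvalP.
case=> Y sD sP PD r tr R sz; split; last by apply/eqP.
  apply/and5P; split=> //; first exact/youngP.
  - by apply/fsubsetP => -[i j] /PD.
  - apply/forallP => p; apply/implyP; have : val p \in P by [apply: fsvalP]; case: (val p) => i j ij nr.
    by rewrite point_leftE (point_aboveE _ _ sP) tr //; case: leftp.
  apply/andP; split; apply/forallP => p; apply/existsP; have : val p \in D by apply: fsvalP.
    by case: (val p) => i j /R[l il]; exists [` il].
  case: (val p) => i j; rewrite sD => /R[l]; rewrite sP => il.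
  by exists [` il].
by apply/andP; split; apply/transpose_fsetP.
Qed.

Lemma sym_tlt_lt n D P m i j :
  sym_tlt n D P -> n.*2 < m -> (i, j) \in D -> (i < m) && (j < m).
Proof.
move=> /mem_symTLT; rewrite symTLTP => /and3P[/tree_like_box/fsubsetP DB _ /eqP sz].
by rewrite sz in DB; move=> nm /DB; rewrite boxE /= => /andP[h1 h2]; rewrite !(leq_trans _ nm).
Qed.

(** * Counting corners, bottom cells and columns *)

Lemma sum_telescope m (d : nat -> bool) :
  ~~ d m -> \sum_(0 <= i < m) d i = d 0 + \sum_(0 <= i < m) d i.+1.
Proof.
move=> /negbTE dm; rewrite -[LHS]addn0 -[X in _ + X]/(nat_of_bool false) -dm.
by rewrite -(@big_nat_recr _ _ _ m 0 (fun i => nat_of_bool (d i))) // big_nat_recl.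
Qed.

(* The addable cell is [(c.1.+1, c.2.+1)]; it is indexed by its north-west
   neighbour [c]. *)
Definition inner (D : {fset cell}) (c : cell) : bool :=
  [&& (c.1.+1, c.2) \in D, (c.1, c.2.+1) \in D & (c.1.+1, c.2.+1) \notin D].

(* The inclusion-exclusion of the indicator of [D] over the square with
   north-west cell [c] is [1] if [c] is a corner, [-1] if [inner D c], and [0]
   otherwise; the sum of these over all squares telescopes to [(0, 0) \in D]. *)
Lemma count_corner D m :
  young_closed D -> (0, 0) \in D ->
  (forall i j, (i, j) \in D -> (i < m) && (j < m)) ->
  count (corner D) (cells m) = (count (inner D) (cells m)).+1.
Proof.
move=> Y r Dm; rewrite !count_cells.
pose d i j := (i, j) \in D.
have dm i : ~~ d m i by apply/negP => /Dm; rewrite ltnn.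
have dm' i : ~~ d i m by apply/negP => /Dm; rewrite ltnn andbF.
pose S a b := \sum_(0 <= i < m) \sum_(0 <= j < m) d (a + i) (b + j).
pose R b := \sum_(0 <= j < m) d 0 (b + j).
have SR b : S 0 b = R b + S 1 b.
  rewrite /S /R exchange_big [X in _ + X]exchange_big -big_split.
  by apply: eq_bigr => j _; rewrite /= (sum_telescope (d := d^~ (b + j))).
have R01 : R 0 = 1 + R 1.
  by rewrite /R (sum_telescope (d := d 0)) // {1}/d r.
suff : \sum_(0 <= i < m) \sum_(0 <= j < m) corner D (i, j) + S 1 0 + S 0 1
     = \sum_(0 <= i < m) \sum_(0 <= j < m) inner D (i, j) + S 0 0 + S 1 1.
  by rewrite !SR R01; lia.
rewrite -!big_split; apply: eq_bigr => i _; rewrite -!big_split; apply: eq_bigr => j _.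
rewrite /corner /inner /= -!/(d _ _) !add0n !add1n.
have : d i.+1 j.+1 -> d i.+1 j by move=> h; apply: Y h _ _.
have : d i.+1 j.+1 -> d i j.+1 by move=> h; apply: Y h _ _.
have : d i.+1 j -> d i j by move=> h; apply: Y h _ _.
have : d i j.+1 -> d i j by move=> h; apply: Y h _ _.
case: (d i j) => [] /=; case: (d i.+1 j); case: (d i j.+1); case: (d i.+1 j.+1);
  by [|move=> /(_ isT)|move=> _ /(_ isT)|move=> _ _ /(_ isT)|move=> _ _ _ /(_ isT)].
Qed.

(** Encodes a column by its lowest cell, so that the choice of a column is also the choice of a cell
    of the grid. *)
Definition bottom (D : {fset cell}) (c : cell) : bool :=
  (c \in D) && ((c.1.+1, c.2) \notin D).

(** In column [j] the indicator of a bottom cell is the drop of the indicator of [D] from row [i] to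
    row [i.+1]; these drops telescope to the membership of [(0, j)]. *)
Lemma count_bottom D m :
  young_closed D -> (forall i j, (i, j) \in D -> (i < m) && (j < m)) ->
  count (bottom D) (cells m) = count (fun j => (0, j) \in D) (iota 0 m).
Proof.
move=> Y Dm; rewrite count_cells exchange_big /=.
rewrite -sum1_count [RHS]big_mkcond /index_iota subn0; apply: eq_bigr => j _.
pose d i := (i, j) \in D; rewrite -[if _ then _ else _]/(nat_of_bool (d 0)).
have dm : ~~ d m by apply/negP => /Dm; rewrite ltnn.
apply/(@addIn (\sum_(0 <= i < m) d i.+1)); rewrite -sum_telescope // /index_iota subn0 -big_split.
apply: eq_bigr => i _; rewrite /bottom /= -!/(d _).
have : d i.+1 -> d i by move=> h; apply: Y h _ _.
by case: (d i); case: (d i.+1) => //= /(_ isT).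
Qed.

Lemma ocE n D P m : sym_tlt n D P -> n.*2 < m ->
  oc (D, P) = count (fun c => (c \in P) && corner D c) (cells m).
Proof.
move=> T nm; rewrite /oc -size_filter; apply/perm_size/uniq_perm.
- exact: fset_uniq.
- exact/filter_uniq/cells_uniq.
move=> [i j]; rewrite !inE /= mem_filter mem_cells; apply/esym/andb_idr.
by case/andP=> /(st_sub T) ij _; exact: (sym_tlt_lt T nm ij).
Qed.

(** Columns are as many as rows, hence as points with no point to their left. Transposition matches
    the non-root points of this kind with the points having one to their left, so the [n.*2.+1]
    points split into [n.+1] and [n]. *)
Lemma sym_tlt_row0 n D P m : sym_tlt n D P -> n.*2 < m ->
  count (fun j => (0, j) \in D) (iota 0 m) = n.+1.
Proof.
move=> T nm; have [Y sD sP PD r tr R sz] := T.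
pose l (p : cell) := leftp P p.1 p.2.
pose nl (p : cell) := ~~ l p.
(* Each row has exactly one point without a point to its left, namely its first one. *)
have -> : count (fun j => (0, j) \in D) (iota 0 m) = count nl P.
  rewrite -!size_filter -(size_map fst (filter nl P)); apply/perm_size/uniq_perm.
  - exact/filter_uniq/iota_uniq.
  - rewrite map_inj_in_uniq; first exact/filter_uniq/fset_uniq.
    move=> [i j] [i' j']; rewrite !mem_filter => /andP[/= /leftpP h hP] /andP[/= /leftpP h' hP'] e.
    rewrite e in h hP *; case: (ltngtP j j') => [lt|lt|-> //].
      by case: h'; exists j.
    by case: h; exists j'.
  move=> i; rewrite mem_filter mem_iota add0n /= sD; apply/andP/mapP => /=.
    case=> /R h _; exists (i, ex_minn h) => //.
    rewrite mem_filter /nl /l /=; case: ex_minnP => k -> mk; rewrite andbT.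
    by apply/leftpP => -[x xk /mk]; rewrite leqNgt xk.
  case=> [[k j]]; rewrite mem_filter => /andP[/= _ /PD kj ->]; split.
    exact: Y kj _ _.
  by case/andP: (sym_tlt_lt T nm kj).
have nl0 : nl (0, 0) by apply/leftpP => -[].
(* For a non-root point, having no point to the left means having one above, and transposition turns
   above into left. *)
have : count l P = count (predD1 nl (0,0)) P.
  rewrite -!size_filter -(size_map transpose); apply/perm_size/uniq_perm.
  - rewrite map_inj_uniq; last by move=> [? ?] [? ?] [-> ->].
    exact/filter_uniq/fset_uniq.
  - exact/filter_uniq/fset_uniq.
  move=> [i j]; rewrite mem_filter; apply/mapP/andP => /=.
    case=> -[k h]; rewrite mem_filter => /andP[/= lh khP] [-> ->].
    have nz : (k, h) != (0, 0) by apply: contraTneq lh => -[-> ->]; apply/leftpP => -[].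
    rewrite -sP; split=> //; rewrite /nl /l /= tr // negbK [leftp _ _ _]lh andbT.
    by apply: contraNneq nz => -[-> ->].
  case=> /andP[nz nlij] ij; exists (j, i) => //.
  by rewrite mem_filter -sP ij andbT /l /= tr.
have := count_predC l P; rewrite -[size _]/(#|` P|) sz.
have -> : count (predC l) P = count nl P by [].
suff -> : count nl P = (count (predD1 nl (0,0)) P).+1 by lia.
have := count_predC (pred1 (0, 0)) (filter nl P).
rewrite size_filter count_uniq_mem ?filter_uniq ?fset_uniq // mem_filter nl0 r => <-.
by rewrite count_filter add1n; congr _.+1; apply: eq_count => p; rewrite /= andbC.
Qed.

(** * Removing and adding empty corners *)

(** A cell further down or further right would force the cell just below or just right of the corner
    into [D]. *)
Lemma corner_max D i j k l :
  young_closed D -> corner D (i, j) -> (k, l) \in D -> i <= k -> j <= l ->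
  k = i /\ l = j.
Proof.
move=> Y /and3P[_ /= /negP ci /negP cj] kl; rewrite leq_eqVlt => /predU1P[ik|ik] jl.
  subst k; split=> //; apply/eqP; rewrite eqn_leq jl andbT leqNgt.
  by apply/negP => lj; case: cj; apply: Y kl _ _.
by case: ci; apply: Y kl _ _.
Qed.

Lemma corner_sym (D : {fset cell}) i j :
  (forall i j : nat, ((i, j) \in D) = ((j, i) \in D)) -> corner D (j, i) = corner D (i, j).
Proof. by move=> sD; rewrite /corner /= (sD j i) (sD j.+1 i) (sD j i.+1); congr andb; apply: andbC. Qed.

Lemma mem_sym_pair (i j k l : nat) :
  ((k, l) \in [fset (i, j); (j, i)]) = ((k == i) && (l == j)) || ((k == j) && (l == i)).
Proof. by rewrite !inE !xpair_eqE. Qed.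

(** The tree condition and the size depend on the points alone, and rows stay nonempty because every
    row of [E] is already a row of [D]. *)
Lemma sym_tlt_reshape n D E P :
  sym_tlt n D P -> young_closed E ->
  (forall i j : nat, ((i, j) \in E) = ((j, i) \in E)) ->
  (forall i j : nat, (i, j) \in P -> (i, j) \in E) ->
  (forall i j : nat, (i, j) \in E -> exists l : nat, (i, l) \in D) -> sym_tlt n E P.
Proof.
case=> Y sD sP PD r tr R sz YE sE PE RE.
by split=> // i j /RE[l /R].
Qed.

(** The returned cell is the north-west neighbour of the removed corner, matching the indexing of
    [inner]. On the diagonal the two removed cells coincide. *)
Definition remove_corner (x : tableau * cell) : tableau * cell :=
  let: ((D, P), (i, j)) := x in
  ((D `\` [fset (i, j); (j, i)], P), (i.-1, j.-1)).

Definition fill_inner (x : tableau * cell) : tableau * cell :=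
  let: ((D, P), (i, j)) := x in
  ((D `|` [fset (i.+1, j.+1); (j.+1, i.+1)], P), (i.+1, j.+1)).

(** A corner in column 0 is the only cell of its row, so it must hold the point of that row. *)
Lemma empty_corner_gt0 n D P i j :
  sym_tlt n D P -> (i, j) \notin P -> corner D (i, j) -> 0 < j.
Proof.
case=> Y sD sP PD r tr R sz ijP cij; rewrite lt0n; apply/eqP => j0; subst j.
have /and3P[ijD _ _] := cij; have [l il] := R _ _ ijD.
have [_ l0] := corner_max Y cij (PD _ _ il) (leqnn i) (leq0n l).
by rewrite l0 (negbTE ijP) in il.
Qed.

Lemma sum_empty_corner n m : n.*2 < m ->
  \sum_(T <- symTLT n) count (fun c => (c \notin T.2) && corner T.1 c) (cells m)
  = \sum_(T <- symTLT n) count (inner T.1) (cells m).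
Proof.
move=> nm; apply/eqP; rewrite eqn_leq; apply/andP; split.
  apply: (leq_sum_count (f := remove_corner) (g := fill_inner)).
  - exact: fset_uniq.
  - exact: cells_uniq.
  move=> [D P] [i j] /mem_symTLT T; rewrite mem_cells => /andP[im jm] /= /andP[ijP cij].
  have [Y sD sP PD r tr R sz] := T.
  have cji := corner_sym i j sD; rewrite cij in cji.
  have j0 := empty_corner_gt0 T ijP cij.
  have i0 : 0 < i by apply: (empty_corner_gt0 (i := j) T) => //; rewrite -sP.
  have /and3P[ijD _ _] := cij; have /and3P[jiD _ _] := cji.
  have inE' k l : ((k, l) \in D `\` [fset (i, j); (j, i)]) =
      ((k, l) \notin [fset (i, j); (j, i)]) && ((k, l) \in D) by rewrite in_fsetD.
  split; last 1 first.
  - rewrite !prednK //; congr (_, _, _); apply/fsetP => -[k l].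
    rewrite in_fsetU inE'; case kl: (_ \in [fset _; _]); rewrite ?orbF //=.
    by move: kl; rewrite mem_sym_pair => /orP[] /andP[/eqP-> /eqP->].
  - apply/mem_symTLT/(sym_tlt_reshape T).
    + move=> a b k l; rewrite !inE' => /andP[abn abD] ka lb.
      rewrite (Y _ _ _ _ abD ka lb) andbT; apply: contra abn.
      rewrite mem_sym_pair => /orP[] /andP[/eqP ek /eqP el]; subst k l.
        by have [-> ->] := corner_max Y cij abD ka lb; rewrite mem_sym_pair !eqxx.
      by have [-> ->] := corner_max Y cji abD ka lb; rewrite mem_sym_pair !eqxx orbT.
    + by move=> a b; rewrite !inE' !mem_sym_pair (sD a b); congr andb; lia.
    + move=> a b ab; rewrite inE' PD // andbT; apply: contra ijP; rewrite mem_sym_pair.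
      by case/orP=> /andP[/eqP e /eqP e']; subst a b; rewrite // sP.
    + by move=> a b; rewrite inE' => /andP[_ ab]; exists b.
  - by rewrite mem_cells; lia.
  rewrite /inner /= !prednK // !inE' (Y _ _ _ _ ijD) ?leq_pred // (Y _ _ _ _ ijD) ?leq_pred //.
  by rewrite !mem_sym_pair; lia.
apply: (leq_sum_count (f := fill_inner) (g := remove_corner)).
- exact: fset_uniq.
- exact: cells_uniq.
move=> [D P] [i j] /mem_symTLT T; rewrite mem_cells => /andP[im jm] /= /and3P[/= h1 h2 h3].
have [Y sD sP PD r tr R sz] := T.
have inE' k l : ((k, l) \in D `|` [fset (i.+1, j.+1); (j.+1, i.+1)]) =
  ((k, l) \in D) || ((k, l) \in [fset (i.+1, j.+1); (j.+1, i.+1)]) by rewrite in_fsetU.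
split; last 1 first.
- rewrite /=; congr (_, _, _); apply/fsetP => -[k l].
  rewrite in_fsetD inE'; case kl: (_ \in [fset _; _]); rewrite ?orbF //=.
  apply/esym/negbTE; move: kl; rewrite mem_sym_pair => /orP[] /andP[/eqP-> /eqP->] //.
  by rewrite -sD.
- apply/mem_symTLT/(sym_tlt_reshape T).
  (* Every cell north-west of an addable cell is that cell itself or lies in [D]. *)
  + have aux a b k l : (a.+1, b) \in D -> (a, b.+1) \in D -> k <= a.+1 -> l <= b.+1 ->
        ((k, l) \in D) || ((k == a.+1) && (l == b.+1)).
      move=> hab hba; rewrite leq_eqVlt => /predU1P[->|ka].
        rewrite leq_eqVlt => /predU1P[->|lb]; first by rewrite !eqxx orbT.
        by rewrite (Y _ _ _ _ hab).
      by move=> lb; rewrite (Y _ _ _ _ hba).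
    move=> a b k l; rewrite !inE' => /orP[abD ka lb|]; first by rewrite (Y _ _ _ _ abD).
    rewrite !mem_sym_pair => /orP[] /andP[/eqP-> /eqP->] ka lb.
      by rewrite orbA aux.
    by rewrite [X in _ || X]orbC orbA aux // sD.
  + by move=> a b; rewrite !inE' !mem_sym_pair (sD a b); congr orb; lia.
  + by move=> a b /PD ab; rewrite inE' ab.
  + move=> a b; rewrite inE' mem_sym_pair => /orP[ab|/orP[] /andP[/eqP-> _]].
    * by exists b.
    * by exists j.
    * by exists i; rewrite sD.
- have /andP := sym_tlt_lt T nm h1; have /andP := sym_tlt_lt T nm h2.
  by rewrite mem_cells; lia.
rewrite /= (contra (@PD _ _) h3) /corner /= !inE' mem_sym_pair !eqxx orbT /=.
(* The cells just below and just right of the new corner are not in [D], as they would force the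
   addable cell into [D]; nor are they the mirror cell, which is never adjacent to the new
   corner. *)
have n1 : (i.+2, j.+1) \notin D by apply: contra h3 => h; apply: Y h _ _.
have n2 : (i.+1, j.+2) \notin D by apply: contra h3 => h; apply: Y h _ _.
by rewrite (negbTE n1) (negbTE n2) !mem_sym_pair; lia.
Qed.

Lemma card_symTLT_oc n : #|` symTLT n| = \sum_(T <- symTLT n) oc T.
Proof.
have nm : n.*2 < n.*2.+1 by [].
(* With the addable cells added to both sides, and traded on the right for empty corners, the
   identity holds tableau by tableau. *)
apply: (@addnI (\sum_(T <- symTLT n) count (inner T.1) (cells n.*2.+1))).
rewrite -{2}(sum_empty_corner nm) -sum1_size -!big_split /=.
apply: eq_big_seq => -[D P] /mem_symTLT T /=.
have Dm i j : (i, j) \in D -> (i < n.*2.+1) && (j < n.*2.+1) by apply: sym_tlt_lt T nm.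
rewrite addn1 -(count_corner (st_young T) (st_sub T (st_root T)) Dm) (ocE T nm).
rewrite [RHS]addnC -[LHS]size_filter -(count_predC [pred c | c \in P]) !count_filter.
by [].
Qed.

(** * Base case: the tableau with a single cell *)

Lemma card_symTLT0 : #|` symTLT 0| = 1.
Proof.
pose O := [fset (0, 0) : cell].
have mO i j : ((i, j) \in O) = (i == 0) && (j == 0) by rewrite inE xpair_eqE.
suff -> : symTLT 0 = [fset (O, O)] by rewrite cardfs1.
apply/fsetP => -[D P]; rewrite inE; apply/mem_symTLT/eqP => [T|[-> ->]].
  have [Y sD sP PD r tr R /eqP/cardfs1P[p pE]] := T.
  have PE : P = O by rewrite pE in r *; move: r; rewrite inE => /eqP <-.
  congr pair => //; apply/fsetP => -[i j]; rewrite mO; apply/idP/andP => [ij|[/eqP-> /eqP->]].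
    have [l] := R _ _ ij; rewrite PE mO => /andP[-> _].
    by move: ij; rewrite sD => /R[k]; rewrite PE mO => /andP[-> _].
  exact: PD.
split=> [i j k l|i j|i j|i j|||i j|]; rewrite ?mO ?cardfs1 //; try by rewrite andbC.
- by case/andP=> /eqP-> /eqP->; rewrite !leqn0 => -> ->.
- by move=> i j; rewrite mO xpair_eqE => ->.
- by case/andP=> /eqP-> _; exists 0; rewrite mO.
Qed.

(** * Inserting and deleting the row of an occupied corner *)

(** Nothing lies to the right of a corner, so these are the occupied corners alone in their row. *)
Definition rowcorner (T : tableau) (c : cell) : bool :=
  [&& c \in T.2, corner T.1 c & ~~ leftp T.2 c.1 c.2].

(* Row [h] and column [h] are new: row [h] has length [q.+1] and its only point
   is in its last cell. *)
Definition insD (D : {fset cell}) (h q x y : nat) : bool :=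
  if x == h then y <= q else if y == h then x <= q
  else (unbump h x, unbump h y) \in D.

Definition insP (P : {fset cell}) (h q x y : nat) : bool :=
  if x == h then y == q else if y == h then x == q
  else (unbump h x, unbump h y) \in P.

(** Turns a predicate on coordinates into a finite set; [m] is meant to bound its support. *)
Definition box_set (m : nat) (f : nat -> nat -> bool) : {fset cell} :=
  [fset c in box m | f c.1 c.2].

Lemma mem_box_set m (f : nat -> nat -> bool) :
  (forall x y, f x y -> (x < m) && (y < m)) ->
  forall x y, ((x, y) \in box_set m f) = f x y.
Proof.
move=> fm x y; rewrite in_fset /= inE /= boxE /=; apply/andb_idl => /fm; exact.
Qed.

(** The new row [h] goes directly below the bottom cell [(k, c)]; [q] is the index of column [c]
    once column [h] has been inserted. *)
Definition insert_corner (m : nat) (x : tableau * cell) : tableau * cell :=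
  let: ((D, P), (k, c)) := x in let h := k.+1 in let q := bump h c in
  ((box_set m (insD D h q), box_set m (insP P h q)), (h, q)).

Definition delete_corner (m : nat) (x : tableau * cell) : tableau * cell :=
  let: ((D, P), (h, q)) := x in
  ((box_set m (fun x y => (bump h x, bump h y) \in D),
    box_set m (fun x y => (bump h x, bump h y) \in P)), (h.-1, unbump h q)).

Lemma bump_lt h i j : (bump h i < bump h j) = (i < j).
Proof. by rewrite /bump; lia. Qed.

Lemma bump_neq h i : (bump h i == h) = false.
Proof. by rewrite eq_sym; apply/negbTE/neq_bump. Qed.

Lemma unbump_lt h i j : i != h -> j != h -> (unbump h i < unbump h j) = (i < j).
Proof. by move=> ih jh; rewrite -(bump_lt h) !unbumpK. Qed.

Lemma unbump_leq h i j : i <= j -> unbump h i <= unbump h j.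
Proof. rewrite /unbump; lia. Qed.

Lemma unbump_leq_bump h i j : i <= bump h j -> unbump h i <= j.
Proof. by move/(unbump_leq h); rewrite bumpK. Qed.

Lemma leq_unbump_bump h i j : bump h j < i -> j <= unbump h i.
Proof. by move/ltnW/(unbump_leq h); rewrite bumpK. Qed.

Lemma leq_unbump h i : h < i -> h <= unbump h i.
Proof. rewrite /unbump; lia. Qed.

Lemma unbump_small h i : i <= h -> unbump h i = i.
Proof. by move=> ih; rewrite /unbump ltnNge ih subn0. Qed.

Lemma unbumpE h x : x != h -> exists x', x = bump h x'.
Proof. by exists (unbump h x); rewrite unbumpK. Qed.

(** Off the diagonal the new point and its mirror image are distinct, and the old points are
    renumbered injectively. *)
Lemma card_insP (P E : {fset cell}) h q : q != h ->
  (forall x y, ((x, y) \in E) = insP P h q x y) -> #|` E| = #|` P|.+2.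
Proof.
move=> qh EP.
pose f (c : cell) := (bump h c.1, bump h c.2).
have fI : injective f by move=> [a b] [a' b'] [/(can_inj (bumpK h)) -> /(can_inj (bumpK h)) ->].
rewrite -[#|` P|](size_map f); apply: (@perm_size _ E ((h, q) :: (q, h) :: map f P)).
have nf a b : (a, b) \in map f P -> (a != h) && (b != h).
  by case/mapP=> [[k l] _ [-> ->]]; rewrite !bump_neq.
apply: uniq_perm; first exact: fset_uniq.
  rewrite /= (map_inj_uniq fI) fset_uniq andbT inE negb_or xpair_eqE eq_sym (negbTE qh) /=.
  by apply/andP; split; apply/negP => /nf; rewrite eqxx ?andbF.
move=> [x y]; rewrite EP /insP !inE !xpair_eqE.
have [->|xh] := eqVneq x h.
  rewrite [h == q]eq_sym (negbTE qh) /=; apply/esym/orb_idr => /nf.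
  by rewrite eqxx.
have [->|yh] := eqVneq y h.
  by rewrite andbT /=; apply/esym/orb_idr => /nf; rewrite eqxx andbF.
rewrite andbF /=; have [a ->] := unbumpE xh; have [b ->] := unbumpE yh.
by rewrite !bumpK -[(bump h a, _)]/(f (a, b)) mem_map.
Qed.

(** No old cell lies weakly south-east of [(h, c)], so the new row fits and ends in a corner, whose
    point hangs from a point of column [c]. *)
Lemma insert_sym_tlt n (D P D1 P1 : {fset cell}) k c (h := k.+1) (q := bump h c) :
  sym_tlt n D P -> bottom D (k, c) ->
  (forall x y, ((x, y) \in D1) = insD D h q x y) ->
  (forall x y, ((x, y) \in P1) = insP P h q x y) ->
  sym_tlt n.+1 D1 P1 /\ rowcorner (D1, P1) (h, q).
Proof.
move=> T /andP[/= kc hc] D1E P1E; have [Y sD sP PD r tr R sz] := T.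
rewrite -/h in hc; have ck : (c, k) \in D by rewrite sD.
have ch : (c, h) \notin D by rewrite sD.
have qh : q != h by rewrite bump_neq.
have sD1 x y : ((x, y) \in D1) = ((y, x) \in D1).
  rewrite !D1E /insD; have [xh|xh] := eqVneq x h; have [yh|yh] := eqVneq y h => //.
    by rewrite xh yh.
have sP1 x y : ((x, y) \in P1) = ((y, x) \in P1).
  rewrite !P1E /insP; have [xh|xh] := eqVneq x h; have [yh|yh] := eqVneq y h => //.
    by rewrite xh yh.
have nY a b : h <= a -> c <= b -> (a, b) \in D = false.
  by move=> ha cb; apply: contraNF hc => ab; apply: Y ab _ _.
have PD1 x y : (x, y) \in P1 -> (x, y) \in D1.
  rewrite P1E D1E /insP /insD; case: eqVneq => _; first by move/eqP->.
  by case: eqVneq => _; [move/eqP-> | apply: PD].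
have hqP : (h, q) \in P1 by rewrite P1E /insP !eqxx.
have nl : leftp P1 h q = false.
  by apply/leftpP => -[l lq]; rewrite P1E /insP eqxx => /eqP e; rewrite e ltnn in lq.
(* Transposed: column [c] contains a point, necessarily above row [h], so the new corner has a point
   above it. *)
have lq : leftp P1 q h.
  have [l cl] := R _ _ ck.
  have lh : l < h.
    by rewrite ltnNge; apply: contra ch => hl; apply: Y (PD _ _ cl) _ _.
  apply/leftpP; exists l => //.
  by rewrite P1E /insP (negbTE qh) (ltn_eqF lh) bumpK /unbump ltnNge (ltnW lh) subn0.
(* The new point of column [h] lies in row [q], where no old cell is to its right; hence it is to
   the left of no old point. *)
have lE x y : x != h -> y != h -> (x, y) \in P1 -> leftp P1 x y = leftp P (unbump h x) (unbump h y).
  move=> xh yh; rewrite P1E /insP (negbTE xh) (negbTE yh) => xy.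
  apply/leftpP/leftpP => -[l ly].
    rewrite P1E /insP (negbTE xh); have [e|lh] := eqVneq l h => [/eqP xq|xl].
      by have := PD _ _ xy; rewrite xq bumpK sD nY // leq_unbump // -e.
    by exists (unbump h l); rewrite // unbump_lt.
  exists (bump h l); last by rewrite P1E /insP (negbTE xh) bump_neq bumpK.
  by rewrite -[y in _ < y](unbumpK (h := h)) ?bump_lt.
have c1 : (h.+1, q) \notin D1.
  by rewrite D1E /insD (negbTE qh) gtn_eqF // bumpK nY // /unbump ltnSn subn1.
have c2 : (h, q.+1) \notin D1 by rewrite D1E /insD eqxx ltnn.
split; last by rewrite /rowcorner /= hqP nl /corner /= PD1 // c1 c2.
split=> //.
- move=> x y x2 y2; rewrite !D1E /insD => + xx yy.
  have [x2h|x2h] := eqVneq x2 h.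
    have [xh|xh] := eqVneq x h; first by move=> yq; apply: leq_trans yq.
    have hx : h < x by rewrite ltn_neqAle eq_sym xh -x2h.
    have [yh|yh] := eqVneq y h.
      by move=> xq; rewrite -yh in hx; apply: leq_trans yy (leq_trans (ltnW hx) xq).
    (* An old cell below the new row lies in a column before [c], by [nY], so row [h] reaches at
       least as far. *)
    rewrite leqNgt; apply: contraTN => y2q; rewrite nY ?leq_unbump //.
    exact/leq_unbump_bump/(leq_trans y2q).
  have [y2h|y2h] := eqVneq y2 h.
    have [yh|yh] := eqVneq y h.
      have [xh|xh] := eqVneq x h; last by move=> xq; apply: leq_trans xq.
      by rewrite yh => hq; apply: leq_trans hq; rewrite -xh.
    have hy : h < y by rewrite ltn_neqAle eq_sym yh -y2h.
    have [xh|xh] := eqVneq x h.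
      by move=> yq; rewrite -xh in hy; apply: leq_trans xx (leq_trans (ltnW hy) yq).
    rewrite leqNgt; apply: contraTN => x2q; rewrite sD nY ?leq_unbump //.
    exact/leq_unbump_bump/(leq_trans x2q).
  have [xh|xh] := eqVneq x h.
    move=> yq; apply: (Y _ _ _ _ kc); last exact/unbump_leq_bump/(leq_trans yy).
    by rewrite unbump_small -?xh // -ltnS -/h ltn_neqAle x2h -xh.
  have [yh|yh] := eqVneq y h.
    move=> xq; apply: (Y _ _ _ _ ck); first exact/unbump_leq_bump/(leq_trans xx).
    by rewrite unbump_small -?yh // -ltnS -/h ltn_neqAle y2h -yh.
  by move=> xy; apply: (Y _ _ _ _ xy); apply: unbump_leq.
- by rewrite P1E.
- move=> x y xy nz; have [xh|xh] := eqVneq x h.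
    move: xy; rewrite P1E /insP xh eqxx => /eqP ->.
    by rewrite nl lq.
  have [yh|yh] := eqVneq y h.
    move: xy; rewrite P1E /insP (negbTE xh) yh eqxx => /eqP ->.
    by rewrite nl lq.
  rewrite !lE //; last by rewrite sP1.
  apply: tr.
    by move: xy; rewrite P1E /insP (negbTE xh) (negbTE yh).
  apply: contra nz; rewrite !xpair_eqE => /andP[x0 y0].
  have z0 z : z != h -> unbump h z == 0 -> z == 0.
    by move=> zh /eqP z0; rewrite -[z](unbumpK (h := h)) // z0.
  by apply/andP; split; apply: z0.
- have Rx x y : x != h -> (unbump h x, y) \in D -> exists l, (x, l) \in P1.
    move=> xh /R[l xl]; exists (bump h l).
    by rewrite P1E /insP (negbTE xh) bump_neq bumpK.
  move=> x y; have [->|xh] := eqVneq x h; first by exists q.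
  rewrite D1E /insD (negbTE xh); have [yh|yh] := eqVneq y h; last exact: Rx.
  (* An old row crossed by the new column also meets the old column [k], which reaches row [c]. *)
  move=> xq; apply: (Rx x k xh); apply: (Y _ _ _ _ ck) => //.
  exact: unbump_leq_bump.
- by rewrite (card_insP qh P1E) sz doubleS.
Qed.

(** Row [h] and column [h] carry only the corner point and its mirror image, and no surviving point
    relies on either. The last two conclusions say that insertion restores the tableau. *)
Lemma delete_sym_tlt n (D P D1 P1 : {fset cell}) h q :
  sym_tlt n.+1 D P -> rowcorner (D, P) (h, q) ->
  (forall x y, ((x, y) \in D1) = ((bump h x, bump h y) \in D)) ->
  (forall x y, ((x, y) \in P1) = ((bump h x, bump h y) \in P)) ->
  [/\ 0 < h /\ q != h, sym_tlt n D1 P1, bottom D1 (h.-1, unbump h q),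
      (forall x y, ((x, y) \in D) = insD D1 h q x y) &
      (forall x y, ((x, y) \in P) = insP P1 h q x y)].
Proof.
move=> T /and3P[/= hqP hqc nl] D1E P1E; have [Y sD sP PD r tr R sz] := T.
have qhc : corner D (q, h) by rewrite corner_sym.
have cm k l : (k, l) \in D -> h <= k -> q <= l -> k = h /\ l = q by apply: corner_max.
(* Were the root a corner, it would be the only cell, but there are at least three points. *)
have nz : (h, q) != (0, 0).
  apply/eqP => -[h0 q0]; have : P `<=` [fset (0, 0)].
    apply/fsubsetP => -[i j] /PD ij; have [] := cm _ _ ij; rewrite ?h0 ?q0 // => -> ->.
    by rewrite inE.
  by move/fsubset_leq_card; rewrite sz cardfs1 doubleS.
have lqh : leftp P q h by rewrite tr.
(* On the diagonal, a point above would reflect to a point on the left. *)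
have qh : q != h by apply: contraNneq nl => e; move: lqh; rewrite e.
have h0 : 0 < h by move: lqh; case: (h).
have rowh l : (h, l) \in P -> l = q.
  move=> hl; case: (ltngtP l q) => // [lq|ql].
    by case/leftpP: nl; exists l.
  by case: (cm _ _ (PD _ _ hl)) => //; apply: ltnW.
have DE x y : ((x, y) \in D) = insD D1 h q x y.
  rewrite /insD; have [->|xh] := eqVneq x h.
    apply/idP/idP => [hy|yq]; last by apply: Y (PD _ _ hqP) _ _.
    by rewrite leqNgt; apply/negP => qy; have [//|_ e] := cm _ _ hy _ (ltnW qy); lia.
  have [->|yh] := eqVneq y h; last by rewrite D1E !unbumpK.
  apply/idP/idP => [hy|yq]; last by rewrite sD; apply: Y (PD _ _ hqP) _ _.
  by rewrite leqNgt; apply/negP => qy; rewrite sD in hy; have [//|_ e] := cm _ _ hy _ (ltnW qy); lia.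
have PE x y : ((x, y) \in P) = insP P1 h q x y.
  rewrite /insP; have [->|xh] := eqVneq x h.
    by apply/idP/eqP => [/rowh|->].
  have [->|yh] := eqVneq y h; last by rewrite P1E !unbumpK.
  by rewrite sP; apply/idP/eqP => [/rowh|->].
have lE x y : (x, y) \in P1 -> leftp P1 x y = leftp P (bump h x) (bump h y).
  rewrite P1E => xy; apply/leftpP/leftpP => -[l ly].
    by rewrite P1E; exists (bump h l); rewrite ?bump_lt.
  have [lh|lh] := eqVneq l h; last first.
    by move=> xl; exists (unbump h l); rewrite ?P1E ?unbumpK // -(bump_lt h) unbumpK.
  (* The deleted point of column [h] is at the corner [(q, h)], so nothing lies to its right. *)
  rewrite lh in ly *; rewrite sP => /rowh e; have := PD _ _ xy; rewrite e sD => yq.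
  by have [||/eqP] := cm _ _ yq; rewrite ?bump_neq ?(ltnW ly).
have b0 : bump h 0 = 0 by rewrite /bump leqNgt h0.
split=> //; last first.
  rewrite /bottom prednK // !D1E /= !unbumpK //; apply/andP; split.
    by apply: Y (PD _ _ hqP) _ _; rewrite // /bump; lia.
  by rewrite /bump leqnn; case/and3P: hqc.
split.
- by move=> a b k l; rewrite !D1E => ab ka lb; apply: Y ab _ _; rewrite leq_bump2.
- by move=> i j; rewrite !D1E sD.
- by move=> i j; rewrite !P1E sP.
- by move=> i j; rewrite P1E D1E; apply: PD.
- by rewrite P1E b0.
- move=> i j ij ijz; rewrite !lE //; last by rewrite P1E sP -P1E.
  apply: tr; rewrite -?P1E //; apply: contra ijz.
  by rewrite !xpair_eqE /bump; lia.
- move=> i j; rewrite D1E => /R[l]; have [->|lh] := eqVneq l h; last first.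
    by move=> il; exists (unbump h l); rewrite P1E unbumpK.
  (* Only row [q] loses its point in column [h], and it keeps the one that [lqh] provides to the
     left. *)
  rewrite sP => /rowh e; have [l' l'h ql'] := leftpP _ _ _ lqh.
  exists (unbump h l'); rewrite P1E e unbumpK //=.
  by rewrite inE (ltn_eqF l'h).
have := card_insP qh PE; rewrite sz doubleS; lia.
Qed.

Lemma sum_rowcorner n (m := n.*2.+3) :
  \sum_(T <- symTLT n.+1) count (rowcorner T) (cells m)
  = \sum_(T <- symTLT n) count (bottom T.1) (cells m).
Proof.
apply/eqP; rewrite eqn_leq; apply/andP; split.
  apply: (leq_sum_count (f := delete_corner m) (g := insert_corner m)).
  - exact: fset_uniq.
  - exact: cells_uniq.
  move=> [D P] [h q] /mem_symTLT T; rewrite mem_cells => /andP[hm qm] rc.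
  have Dm i j : (i, j) \in D -> (i < m) && (j < m) by apply: sym_tlt_lt T _.
  have bD x y : (bump h x, bump h y) \in D -> (x < m) && (y < m).
    by move/Dm; rewrite /bump; lia.
  have bP x y (xy : (bump h x, bump h y) \in P) := bD x y (st_sub T xy).
  have [[h0 qh] T1 bot DE PE] := delete_sym_tlt T rc (mem_box_set bD) (mem_box_set bP).
  split=> //; first exact/mem_symTLT.
    by rewrite mem_cells /unbump /=; lia.
  have qE : bump h (unbump h q) = q by rewrite unbumpK.
  rewrite /= prednK // qE; congr (_, _, _); apply/fsetP => -[x y].
    by rewrite mem_box_set // => a b; rewrite -DE => /Dm.
  by rewrite mem_box_set // => a b; rewrite -PE => /(st_sub T)/Dm.
apply: (leq_sum_count (f := insert_corner m) (g := delete_corner m)).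
- exact: fset_uniq.
- exact: cells_uniq.
move=> [D P] [k c] /mem_symTLT T; rewrite mem_cells => /andP[km cm] /= bot.
(* The bound for the smaller size leaves room below [m] for the shift of indices. *)
have Dm i j : (i, j) \in D -> (i <= n.*2) && (j <= n.*2).
  by move/(sym_tlt_lt T (ltnSn _)).
have /andP[/Dm kc _] := bot.
have bD x y : insD D k.+1 (bump k.+1 c) x y -> (x < m) && (y < m).
  rewrite /insD /m; case: eqP => [|xh]; last case: eqP => [|yh].
  - by move: kc; rewrite /bump; lia.
  - by move: kc; rewrite /bump; lia.
  - by move/Dm; rewrite /unbump; lia.
have bP x y : insP P k.+1 (bump k.+1 c) x y -> (x < m) && (y < m).
  rewrite /insP /m; case: eqP => [|xh]; last case: eqP => [|yh].
  - by move: kc; rewrite /bump; lia.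
  - by move: kc; rewrite /bump; lia.
  - by move/(st_sub T)/Dm; rewrite /unbump; lia.
have DE := mem_box_set bD; have PE := mem_box_set bP.
have [T1 rc] := insert_sym_tlt T bot DE PE.
split=> //; first exact/mem_symTLT.
  by rewrite mem_cells /bump /m; move: kc; lia.
rewrite /= bumpK; congr (_, _, _); apply/fsetP => -[x y].
  have e : forall x y, ((bump k.+1 x, bump k.+1 y) \in box_set m (insD D k.+1 (bump k.+1 c))) = ((x, y) \in D).
    by move=> a b; rewrite DE /insD !bump_neq !bumpK.
  by rewrite mem_box_set /= => [|a b]; rewrite e // => /Dm; rewrite /m; lia.
have e : forall x y, ((bump k.+1 x, bump k.+1 y) \in box_set m (insP P k.+1 (bump k.+1 c))) = ((x, y) \in P).
  by move=> a b; rewrite PE /insP !bump_neq !bumpK.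
by rewrite mem_box_set /= => [|a b]; rewrite e // => /(st_sub T)/Dm; rewrite /m; lia.
Qed.

(** * Recurrence and conclusion *)

(** With at least three points the root is no corner, so an occupied corner has a point on its left
    or above but not both; transposition exchanges the two kinds. *)
Lemma oc_rowcorner n D P m : sym_tlt n.+1 D P -> n.+1.*2 < m ->
  oc (D, P) = (count (rowcorner (D, P)) (cells m)).*2.
Proof.
move=> T nm; have [Y sD sP PD r tr R sz] := T.
rewrite (ocE T nm) -addnn !count_cells [X in _ + X]exchange_big -!big_split.
apply: eq_bigr => i _; rewrite -big_split; apply: eq_bigr => j _.
rewrite /rowcorner /= (sP j i) (corner_sym i j sD).
have [ij|//] := boolP ((i, j) \in P); have [c|//] := boolP (corner D (i, j)).
rewrite (tr _ _ ij); first by case: leftp.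
apply/eqP => -[i0 j0]; subst i j; have /fsubset_leq_card : P `<=` [fset (0, 0)].
  apply/fsubsetP => -[i j] /PD ij'.
  by have [-> ->] := corner_max Y c ij' (leq0n _) (leq0n _); rewrite inE.
by rewrite sz cardfs1 doubleS.
Qed.

Lemma sum_oc_succ n :
  \sum_(T <- symTLT n.+1) oc T = (n.+1 * #|` symTLT n|).*2.
Proof.
have nm : n.*2 < n.*2.+3 by lia.
transitivity (\sum_(T <- symTLT n.+1) (count (rowcorner T) (cells n.*2.+3)).*2).
  by apply: eq_big_seq => -[D P] /mem_symTLT T; apply: oc_rowcorner T _; rewrite doubleS.
rewrite -(big_morph _ doubleD (erefl : 0.*2 = 0)) sum_rowcorner; congr double.
move: n.*2.+3 nm => m nm.
rewrite mulnC -sum1_size big_distrl; apply: eq_big_seq => -[D P] /mem_symTLT T /=.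
(* Each smaller tableau contributes one bottom cell for each of its [n.+1] columns. *)
rewrite mul1n -(sym_tlt_row0 T nm) (count_bottom (st_young T)) // => i j.
exact: sym_tlt_lt T nm.
Qed.

Lemma card_symTLT n : #|` symTLT n| = 2 ^ n * n`!.
Proof.
elim: n => [|n IHn]; first exact: card_symTLT0.
rewrite card_symTLT_oc sum_oc_succ IHn expnS factS -mul2n -mulnA.
by congr muln; apply: mulnCA.
Qed.

Theorem theorem3p7 (n : nat) (n_gt0 : 0 < n) :
  (\sum_(T <- symTLT n) oc T)%N = (2 ^ n * n`!)%N
  /\ ((\sum_(T <- symTLT n) oc T)%N%:R / (#|` symTLT n|)%:R = 1 :> rat)%R.
Proof.
rewrite -card_symTLT_oc card_symTLT; split=> //.
by rewrite GRing.divff // Num.Theory.pnatr_eq0 -lt0n muln_gt0 expn_gt0 fact_gt0.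
Qed.
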